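(* Let $\psi\in \mathrm{BV}_{\mathrm{loc}}$, let $w$ be a window function on $(-\pi,\pi)$, and let $\psi_w$ be the $2\pi$-periodic windowed periodization of $\psi$. Suppose that $\psi_w\in C^{s+1}(\mathbb{R})$ for some integer $s\ge 1$, and let $L_s>0$ denote the Lipschitz constant of the $s$-th derivative $\psi_w^{(s)}$ over $[-\pi,\pi]$. Let $0<\rho<\pi$. Then, for every integer $n\ge 1$, $$\left|\ \sup_{x\in[-\rho,\rho]}\left|\psi(x)-R_n^w\psi(x)\right|-K_\infty(\psi,w,\rho)\ \right|\le \frac{4L_s}{s\,n^s},$$ where $K_\infty(\psi,w,\rho)\ge 0$ is given by $$K_\infty(\psi,w,\rho)=\sup_{x\in[-\rho,\rho]}\Big(|\psi(x)|\cdot\big(1-w(x)\big)\Big).$$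
   Context: $\mathrm{BV}_{\mathrm{loc}}$ is the set of functions $f\colon\mathbb{R}\to\mathbb{R}$ that are of bounded variation on every finite interval, normalized by $f(x)=\frac12\big(f(x^+)+f(x^-)\big)$, where $f(x^\pm)$ are the one-sided limits. A window function on $(-\pi,\pi)$ is a function $w\in \mathrm{BV}_{\mathrm{loc}}$ with $0\le w(x)\le 1$ for $x\in(-\pi,\pi)$ and $w(x)=0$ for $x\in\mathbb{R}\setminus(-\pi,\pi)$. (The normalization is only required at interior points of $(-\pi,\pi)$, so that the rectangular window, equal to $1$ on $(-\pi,\pi)$, is allowed.) The windowed periodization $\psi_w\colon\mathbb{R}\to\mathbb{R}$ is the $2\pi$-periodic function with $\psi_w(x)=w(x)\psi(x)$ for $x\in(-\pi,\pi)$ and $\psi_w(\pi)=\frac12\big((w\psi)(-\pi^+)+(w\psi)(\pi^-)\big)$. For $n\ge 1$ and $x\in\mathbb{R}$, $$R_n^w\psi(x)=\sum_{k=-n}^n c_\psi^w(k)e^{ikx},\qquad c_\psi^w(k)=\frac{1}{2\pi}\int_{-\pi}^{\pi}\psi(x)w(x)e^{-ikx}\,\mathrm{d}x.$$ The Lipschitz constant of a function is the smallest constant for which the Lipschitz inequality holds. *)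

(* Defs.v *)
From mathcomp Require Export all_boot all_order all_algebra.
From mathcomp Require Export all_classical all_reals all_analysis.
From mathcomp Require Export complex.
Export Order.TTheory GRing.Theory Num.Theory.
Export numFieldNormedType.Exports.

Set Implicit Arguments.
Unset Strict Implicit.
Unset Printing Implicit Defensive.

Local Open Scope classical_set_scope.
Local Open Scope ring_scope.

Section Defs.
Context {R : realType}.
Implicit Types (f psi w : R -> R) (x t L rho : R).

Definition locally_bounded_variation f : Prop :=
  forall a b : R, a <= b -> bounded_variation a b f.

(* The two one-sided limits exist as soon as f is locally of bounded
   variation, so the total operator lim is harmless here. *)
Definition normalized_at f x : Prop :=
  f x = (lim (f y @[y --> x^'+]) + lim (f y @[y --> x^'-])) / 2.

Definition BV_loc f : Prop :=
  locally_bounded_variation f /\ forall x, normalized_at f x.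

(* The normalization is not imposed at -pi and pi, so that the indicator
   function of the open interval is a window. *)
Definition window_function w : Prop :=
  [/\ locally_bounded_variation w,
      forall x, - pi < x < pi -> normalized_at w x,
      forall x, - pi < x < pi -> 0 <= w x <= 1
    & forall x, ~~ (- pi < x < pi) -> w x = 0].

(* The three clauses determine f: every real is congruent modulo 2 pi to
   exactly one point of the half-open interval from -pi (excluded) to pi. *)
Definition windowed_periodization psi w f : Prop :=
  [/\ periodic f (pi *+ 2),
      forall x, - pi < x < pi -> f x = w x * psi x
    & f pi = (lim (w y * psi y @[y --> (- pi)^'+])
              + lim (w y * psi y @[y --> pi^'-])) / 2].

Definition class_C (m : nat) f : Prop :=
  (forall k : nat, (k < m)%N -> forall x, derivable (derive1n k f) x 1)
  /\ continuous (derive1n m f).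

Definition is_lipschitz_constant (A : set R) f L : Prop :=
  L.-lipschitz_A f /\ forall M : R, M.-lipschitz_A f -> L <= M.

Definition expi t : R[i] := (cos t +i* sin t)%C.

Definition complex_integral (A : set R) (g : R -> R[i]) : R[i] :=
  ((\int[lebesgue_measure]_(x in A) complex.Re (g x))
   +i* (\int[lebesgue_measure]_(x in A) complex.Im (g x)))%C.

Definition windowed_coeff psi w (k : int) : R[i] :=
  ((2 * pi)^-1)%:C%C
  * complex_integral `[- pi, pi]
      (fun x => (psi x * w x)%:C%C * expi (- (k%:~R * x))).

(* The frequencies -n, ..., n are enumerated as j - n with j < 2 n + 1. *)
Definition windowed_partial_sum psi w (n : nat) x : R[i] :=
  \sum_(j < (2 * n).+1)
    let k : int := j%:Z - n%:Z in windowed_coeff psi w k * expi (k%:~R * x).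

Definition sup_error psi w (n : nat) rho : R :=
  sup [set Normc.normc ((psi x)%:C%C - windowed_partial_sum psi w n x)
      | x in `[- rho, rho]].

Definition K_infty psi w rho : R :=
  sup [set `|psi x| * (1 - w x) | x in `[- rho, rho]].

End Defs.

(* Main.v *)
(* On [-rho, rho] one has psi_w = w psi, so psi - R_n = (1 - w) psi +
   (psi_w - R_n), where R_n is the n-th Fourier sum of psi_w.  Everything thus
   reduces to the uniform bound |psi_w - R_n| <= 2 L / (s n^s).  Integrating by
   parts s + 1 times, the frequencies k and -k together contribute at most
   2 L / k^(s+1), and these bounds sum to at most 2 L / (s n^s) over k > n.

   Only the pointwise convergence of the Fourier series along some subsequence
   is needed.  With h(t) = (f(t) - f(x)) / sin((t - x) / 2), which is continuous
   for f differentiable, R_N(x) - f(x) is (2 pi)^-1 times the integral of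
   h(t) sin((N + 1/2) (t - x)), which is small for some large N by Bessel's
   inequality. *)

Require Import Defs.
From mathcomp Require Import measurable_realfun zify ring lra.

Local Open Scope classical_set_scope.
Local Open Scope ring_scope.

Section fourier.
Context {R : realType}.
Set Implicit Arguments.
Unset Strict Implicit.
Implicit Types (f g h F psi w : R -> R) (a b c d e t u x L : R).

(** * Integration over a period *)

Definition cint f : R := \int[lebesgue_measure]_(x in `[- pi, pi]) f x.

(** Continuity is restricted to the closed period because the quotient integrated in
    [fourier_sum_converges] has poles at translates of [x] by multiples of 2 pi. *)
Definition circle_continuous f := {within `[- pi, pi : R], continuous f}.

Lemma circle_continuousW f : continuous f -> circle_continuous f.
Proof. exact: continuous_subspaceT. Qed.

Lemma circle_continuousM f g : circle_continuous f -> circle_continuous g ->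
  circle_continuous (fun t => f t * g t).
Proof. by move=> cf cg z; apply: continuousM; [exact: cf|exact: cg]. Qed.

Lemma circle_continuousD f g : circle_continuous f -> circle_continuous g ->
  circle_continuous (fun t => f t + g t).
Proof. by move=> cf cg z; apply: continuousD; [exact: cf|exact: cg]. Qed.

Lemma circle_continuousZ c f : circle_continuous f ->
  circle_continuous (fun t => c * f t).
Proof.
by move=> cf; apply: circle_continuousM => //; apply: circle_continuousW => z;
  exact: cvg_cst.
Qed.

Lemma circle_integrable f : circle_continuous f ->
  lebesgue_measure.-integrable `[- pi, pi : R] (EFin \o f).
Proof.
by move=> cf; apply: continuous_compact_integrable => //; exact: segment_compact.
Qed.

Lemma cintD f g : circle_continuous f -> circle_continuous g ->
  cint (fun t => f t + g t) = cint f + cint g.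
Proof. by move=> cf cg; apply: RintegralD => //; exact: circle_integrable. Qed.

Lemma cintZ c f : circle_continuous f -> cint (fun t => c * f t) = c * cint f.
Proof. by move=> cf; apply: RintegralZl => //; exact: circle_integrable. Qed.

Lemma eq_cint f g : f =1 g -> cint f = cint g.
Proof. by move=> fg; apply: eq_Rintegral => t _; exact: fg. Qed.

Lemma eq_cint_in f g : (forall t, - pi <= t <= pi -> f t = g t) ->
  cint f = cint g.
Proof. by move=> fg; apply: eq_Rintegral => t; rewrite inE/= in_itv/= => /fg. Qed.

Lemma circle_continuous_sum (n : nat) (G : nat -> R -> R) :
  (forall k, circle_continuous (G k)) ->
  circle_continuous (fun t => \sum_(k < n) G k t).
Proof.
move=> cG; elim: n => [|n IH].
  under eq_fun do rewrite big_ord0.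
  by apply: circle_continuousW => z; exact: cvg_cst.
by under eq_fun do rewrite big_ord_recr; exact: circle_continuousD.
Qed.

Lemma cint_sum (n : nat) (G : nat -> R -> R) :
  (forall k, circle_continuous (G k)) ->
  cint (fun t => \sum_(k < n) G k t) = \sum_(k < n) cint (G k).
Proof.
move=> cG; elim: n => [|n IH].
  under eq_cint do rewrite big_ord0.
  by rewrite big_ord0 /cint Rintegral_cst// mul0r.
under eq_cint do rewrite big_ord_recr.
by rewrite big_ord_recr/= cintD// ?IH//; exact: circle_continuous_sum.
Qed.

Lemma two_pi_gt0 : 0 < 2 * pi :> R.
Proof. by rewrite mulr_gt0 ?pi_gt0. Qed.

Lemma Npi_lt_pi : - pi < pi :> R.
Proof. by have := @pi_gt0 R; lra. Qed.

Lemma cint_cst c : cint (fun=> c) = 2 * pi * c.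
Proof.
rewrite /cint Rintegral_cst//.
have -> : fine (lebesgue_measure `[- pi, pi : R]%classic) = 2 * pi.
  by rewrite lebesgue_measure_itv/= lte_fin Npi_lt_pi/=; ring.
by rewrite mulrC.
Qed.

Lemma normr_cint_le f c : circle_continuous f ->
  (forall t, - pi <= t <= pi -> `|f t| <= c) -> `|cint f| <= 2 * pi * c.
Proof.
move=> cf fc; rewrite -cint_cst.
have ic := circle_integrable cf.
apply: (le_trans (le_normr_Rintegral _ ic)) => //.
apply: le_Rintegral => //.
- apply: (circle_integrable (f := fun t => `|f t|)) => z.
  by apply: continuous_comp; [exact: cf|exact: norm_continuous].
- by apply: circle_integrable; apply: circle_continuousW => z; exact: cvg_cst.
Qed.

Lemma cint_ge0 f : (forall t, 0 <= f t) -> 0 <= cint f.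
Proof. by move=> f0; apply: Rintegral_ge0 => t _; exact: f0. Qed.

Lemma cint_derive F f : (forall t, is_derive t 1 F (f t)) -> continuous f ->
  cint f = F pi - F (- pi).
Proof.
move=> dF cf; rewrite /cint /Rintegral.
have cF : continuous F.
  by move=> t; apply/differentiable_continuous/derivable1_diffP; have [] := dF t.
rewrite (@continuous_FTC2 R f F) ?Npi_lt_pi//.
- exact: circle_continuousW.
- split=> [t _||]; first by have [] := dF t.
  + by apply: cvg_at_right_filter; exact: cF.
  + by apply: cvg_at_left_filter; exact: cF.
- by move=> t _; rewrite derive1E; exact: derive_val.
Qed.

Lemma is_derive_cos_affine c d t :
  is_derive t 1 (fun t => cos (c * t + d)) (- c * sin (c * t + d)).
Proof.
have h : is_derive t 1 (fun t => c * t + d) c.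
  by apply: is_derive_eq; rewrite /GRing.scale/=; ring.
apply: (is_derive_eq (@is_derive1_comp R cos (fun t => c * t + d) t _ _
  (is_derive_cos _) h)).
by rewrite mulrC mulrN mulNr.
Qed.

Lemma is_derive_sin_affine c d t :
  is_derive t 1 (fun t => sin (c * t + d)) (c * cos (c * t + d)).
Proof.
have h : is_derive t 1 (fun t => c * t + d) c.
  by apply: is_derive_eq; rewrite /GRing.scale/=; ring.
apply: (is_derive_eq (@is_derive1_comp R sin (fun t => c * t + d) t _ _
  (is_derive_sin _) h)).
by rewrite mulrC.
Qed.

Lemma continuous_cos_affine c d : continuous (fun t : R => cos (c * t + d)).
Proof.
move=> t; apply/differentiable_continuous/derivable1_diffP.
by have [] := is_derive_cos_affine c d t.
Qed.

Lemma continuous_sin_affine c d : continuous (fun t : R => sin (c * t + d)).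
Proof.
move=> t; apply/differentiable_continuous/derivable1_diffP.
by have [] := is_derive_sin_affine c d t.
Qed.

(** * Decay of the Fourier coefficients *)

Lemma continuous_derivable g : (forall t, derivable g t 1) -> continuous g.
Proof. by move=> dg t; apply/differentiable_continuous/derivable1_diffP. Qed.

Lemma periodic_derive1 g c : periodic g c -> periodic (derive1 g) c.
Proof.
move=> pg u; rewrite /derive1.
suff -> : (fun z => z^-1 *: (g (z + (u + c)) - g (u + c))) =
  (fun z => z^-1 *: (g (z + u) - g u)) by [].
by apply/funext => z; rewrite addrA !pg.
Qed.

Lemma periodic_derive1n g c k : periodic g c -> periodic (derive1n k g) c.
Proof. by move=> pg; elim: k => // k; exact: periodic_derive1. Qed.

Lemma eq_periodicNpi g : periodic g (pi *+ 2) -> g (- pi) = g pi.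
Proof. by move=> pg; rewrite -pg; congr g; ring. Qed.

(** The two arguments differ by [k] full periods of the sine. This cancels the boundary terms of the
    integrations by parts. *)
Lemma sin_affine_Npi (k : nat) d :
  sin (k%:R * - pi + d) = sin (k%:R * pi + d) :> R.
Proof.
rewrite -(periodicn (@sinD2pi R) k (_ + _)); congr sin.
by rewrite -[_ *+ k]mulr_natr; ring.
Qed.

(** The derivative of [g t * sin (k t + d)] has zero integral by periodicity. Writing [- sin] as a
    cosine with phase shifted by [pi / 2] keeps the shape of the integral, so the step can be
    iterated. *)
Lemma cint_ibp g (k : nat) d : periodic g (pi *+ 2) ->
  (forall t, derivable g t 1) -> continuous (derive1 g) ->
  k%:R * cint (fun t => g t * cos (k%:R * t + d)) =
  cint (fun t => derive1 g t * cos (k%:R * t + (d + pi / 2))).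
Proof.
move=> pg dg cg'.
have cg := continuous_derivable dg.
pose u t := derive1 g t * sin (k%:R * t + d).
pose v t := g t * cos (k%:R * t + d).
have cu : circle_continuous u.
  by apply: circle_continuousM; apply: circle_continuousW => //;
    exact: continuous_sin_affine.
have cv : circle_continuous v.
  by apply: circle_continuousM; apply: circle_continuousW => //;
    exact: continuous_cos_affine.
have -> : cint (fun t => derive1 g t * cos (k%:R * t + (d + pi / 2))) = - cint u.
  rewrite -mulN1r -cintZ//; apply: eq_cint => t.
  by rewrite addrA cosDpihalf /u mulrN mulN1r.
have : cint (fun t => u t + k%:R * v t) = 0.
  have dF t : is_derive t 1 (fun t => g t * sin (k%:R * t + d))
      (u t + k%:R * v t).
    have hg : is_derive t 1 g (derive1 g t) by rewrite derive1E; exact: derivableP.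
    apply: (is_derive_eq (is_deriveM hg (is_derive_sin_affine k%:R d t))).
    by rewrite /u /v /GRing.scale/=; ring.
  rewrite (cint_derive dF).
  - by rewrite eq_periodicNpi// sin_affine_Npi subrr.
  - move=> t; apply: continuousD.
      by apply: continuousM; [exact: cg'|exact: continuous_sin_affine].
    apply: continuousM; first exact: cvg_cst.
    by apply: continuousM; [exact: cg|exact: continuous_cos_affine].
rewrite cintD//; last exact: circle_continuousZ.
by rewrite cintZ// => /eqP; rewrite addrC addr_eq0 => /eqP.
Qed.

Lemma class_C_continuous f m j : class_C m f -> (j <= m)%N ->
  continuous (derive1n j f).
Proof.
move=> [df cf]; rewrite leq_eqVlt => /predU1P[->//|jm].
by apply: continuous_derivable; exact: df.
Qed.

(** Each integration by parts adds [pi / 2] to the phase. Its final value is left existential, since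
    the estimates only use that a cosine is at most 1 in absolute value. *)
Lemma cint_ibpn f m (k : nat) d : periodic f (pi *+ 2) -> class_C m f ->
  exists d', k%:R ^+ m * cint (fun t => f t * cos (k%:R * t + d)) =
             cint (fun t => derive1n m f t * cos (k%:R * t + d')).
Proof.
move=> pf Cf.
suff ibpj j : (j <= m)%N -> exists d',
    k%:R ^+ j * cint (fun t => f t * cos (k%:R * t + d)) =
    cint (fun t => derive1n j f t * cos (k%:R * t + d')) by exact: ibpj.
elim: j => [|j IH] jm; first by exists d; rewrite mul1r.
have [d' IH'] := IH (ltnW jm); exists (d' + pi / 2).
rewrite exprS -mulrA IH' cint_ibp//.
- exact: periodic_derive1n.
- by case: Cf => + _; exact.
- exact: (class_C_continuous Cf jm).
Qed.

Lemma cint_cos_decay f m L (k : nat) d : periodic f (pi *+ 2) -> class_C m f ->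
  (forall t, - pi <= t <= pi -> `|derive1n m f t| <= L) -> (0 < k)%N ->
  `|cint (fun t => f t * cos (k%:R * t + d))| <= 2 * pi * L / k%:R ^+ m.
Proof.
move=> pf Cf fL k0.
have kR : 0 < k%:R ^+ m :> R by rewrite exprn_gt0// ltr0n.
rewrite ler_pdivlMr// mulrC -{1}(gtr0_norm kR) -normrM.
have [d' ->] := cint_ibpn k d pf Cf.
apply: normr_cint_le => [|t tpi].
  apply: circle_continuousM; apply: circle_continuousW.
    exact: (class_C_continuous Cf (leqnn _)).
  exact: continuous_cos_affine.
by rewrite normrM (le_trans _ (fL _ tpi))// ler_piMr// cos_max.
Qed.

(** Difference quotients between points of the interval are bounded by [L], and so is their limit.
    It is taken from the right when [t < c] and from the left at [c], so that the increments stay in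
    the interval. *)
Lemma lipschitz_derive1 g L a c : a < c -> L.-lipschitz_`[a, c] g ->
  (forall t, derivable g t 1) ->
  forall t, a <= t <= c -> `|derive1 g t| <= L.
Proof.
move=> ac lip dg t tpi.
have gt : (z^-1 *: (g (z + t) - g t) @[z --> 0^'] --> derive1 g t)%classic.
  have /cvg_ex[l gl] := dg t; rewrite /derive1; apply/cvgP.
  suff e : (fun z => z^-1 *: (g (z + t) - g t)) =
    (fun z => z^-1 *: (g (z *: 1 + t) - g t)) by rewrite e; exact: gl.
  by apply/funext => z; rewrite [z *: 1]mulr1.
have lip' z : a <= z + t <= c -> `|z^-1 *: (g (z + t) - g t)| <= L.
  move=> ztac; have [->|z0] := eqVneq z 0.
    (* For [z = 0] the quotient is 0 by convention, and the claim [0 <= L] comes from the Lipschitz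
       inequality between the distinct endpoints. *)
    rewrite invr0 scale0r normr0.
    have := lip (a, c); rewrite /= !in_itv/= !lexx !(ltW ac) => /(_ (conj isT isT)).
    move=> /(le_trans (normr_ge0 _)); rewrite pmulr_lge0// normr_gt0.
    by rewrite subr_eq0 lt_eqF.
  have := lip (z + t, t); rewrite /= !in_itv/= tpi ztac => /(_ (conj isT isT)).
  rewrite /= addrK => lipz.
  by rewrite normrZ normfV mulrC ler_pdivrMr ?normr_gt0.
move/andP: tpi => [at_ tc].
have [tc'|ct] := ltP t c.
- have /cvg_norm gt' := cvg_dnbhs_at_right gt.
  apply: (cvgr_to_le gt'); near=> z; apply: lip'; apply/andP; split.
    by rewrite (le_trans at_)// lerDr ltW.
  by rewrite -lerBrDr; near: z; apply: nbhs_right_le; rewrite subr_gt0.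
- have /cvg_norm gt' := cvg_dnbhs_at_left gt.
  apply: (cvgr_to_le gt'); near=> z; apply: lip'; apply/andP; split.
    rewrite -lerBlDr; near: z; apply: nbhs_left_ge.
    by rewrite subr_lt0 (lt_le_trans ac).
  by rewrite -lerBrDr (@le_trans _ _ 0)// ?subr_ge0// ltW.
Unshelve. all: by end_near. Qed.

(** Discrete analogue of integrating [x ^ - (s + 1)] from [n] on: each term is dominated by a
    difference of consecutive values of [1 / (s k^s)], and these telescope. *)
Lemma sum_invX_le (s n N : nat) : (1 <= s)%N -> (1 <= n)%N ->
  \sum_(n <= k < N) (k.+1%:R ^+ s.+1)^-1 <= (s%:R * n%:R ^+ s)^-1 :> R.
Proof.
move=> s1 n1.
have step (k : nat) : (0 < k)%N ->
    (k.+1%:R ^+ s.+1)^-1 <=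
    (s%:R * k%:R ^+ s)^-1 - (s%:R * k.+1%:R ^+ s)^-1 :> R.
  move=> k0.
  (* Bernoulli's inequality for [(1 + 1/k) ^ (j + 1)], cleared of denominators. *)
  have bern j : k%:R ^+ j * (k%:R + j.+1%:R) <= k.+1%:R ^+ j.+1 :> R.
    elim: j => [|j IH]; first by rewrite mul1r expr1 -natrD addn1.
    rewrite exprS [leRHS]exprS.
    apply: le_trans (ler_wpM2l _ IH); last by [].
    rewrite [leRHS]mulrCA -mulrA [leLHS]mulrCA ler_wpM2l ?exprn_ge0//.
    rewrite -!natrD -!natrM ler_nat; lia.
  have kR : 0 < k%:R :> R by rewrite ltr0n.
  have sR : 0 < s%:R :> R by rewrite ltr0n.
  have := bern s.
  rewrite [_ ^+ s.+1]exprS.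
  have ks : 0 < k%:R ^+ s :> R by rewrite exprn_gt0.
  have k1s : 0 < k.+1%:R ^+ s :> R by rewrite exprn_gt0.
  move: (_ ^+ s) ks (_ ^+ s) k1s => A A0 B B0 AB.
  have k1R : 0 < k.+1%:R :> R by [].
  rewrite -subr_ge0.
  have -> : (s%:R * A)^-1 - (s%:R * B)^-1 - (k.+1%:R * B)^-1 =
    (k.+1%:R * B - A * (k%:R + s.+1%:R)) / (s%:R * A * B * k.+1%:R) :> R.
    rewrite -!natr1; field.
    by rewrite !gt_eqF// ?natr1.
  by rewrite divr_ge0 ?subr_ge0// !mulr_ge0// ltW.
have tele : \sum_(n <= k < N) (k.+1%:R ^+ s.+1)^-1 <=
    \sum_(n <= k < N)
      ((s%:R * k%:R ^+ s)^-1 - (s%:R * k.+1%:R ^+ s)^-1) :> R.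
  rewrite big_nat_cond [leRHS]big_nat_cond; apply: ler_sum => k /andP[/andP[nk _] _].
  by apply: step; exact: leq_trans nk.
have [nN|Nn] := leqP n N; last first.
  by rewrite big_geq ?(ltnW Nn)// invr_ge0 mulr_ge0// exprn_ge0.
apply: (le_trans tele).
rewrite (telescope_sumr_eq (fun k => - (s%:R * k%:R ^+ s)^-1))//; last first.
  by move=> k _; rewrite opprK addrC.
by rewrite opprK addrC gerBl invr_ge0 mulr_ge0// exprn_ge0.
Qed.

(** * Fourier sums *)

(** Induction on [n], as [2 sin (u/2) cos ((n+1) u)] is the difference of two consecutive
    half-integer sines. Keeping the factor [sin (u / 2)] on the left avoids dividing by its
    zeros. *)
Lemma dirichlet_kernel (n : nat) u :
  sin (u / 2) * (1 + 2 * \sum_(k < n) cos (k.+1%:R * u)) =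
  sin ((n%:R + 2^-1) * u).
Proof.
elim: n => [|n IH].
  by rewrite big_ord0 mulr0 addr0 mulr1 add0r mulrC.
rewrite big_ord_recr/= [2 * _]mulrDr addrA mulrDr IH.
have -> : (n%:R + 2^-1) * u = n.+1%:R * u - u / 2 by rewrite -natr1; field.
have -> : (n.+1%:R + 2^-1) * u = n.+1%:R * u + u / 2 by field.
by rewrite sinB sinD; ring.
Qed.

(** * Orthogonality of half-integer sines and Bessel's inequality *)

Lemma cint_cos (k : nat) d : (0 < k)%N ->
  cint (fun t => cos (k%:R * t + d)) = 0 :> R.
Proof.
move=> k0; have kR : k%:R != 0 :> R by rewrite pnatr_eq0 -lt0n.
have cc : circle_continuous (fun t : R => cos (k%:R * t + d)).
  exact/circle_continuousW/continuous_cos_affine.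
apply: (mulfI kR); rewrite mulr0 -cintZ//.
rewrite (cint_derive (is_derive_sin_affine k%:R d)); last first.
  move=> t; apply: (@continuousM _ _ (fun=> k%:R)); first exact: cvg_cst.
  exact: continuous_cos_affine.
by rewrite sin_affine_Npi subrr.
Qed.

(* The half-integer frequencies sin ((k + 1/2) (t - x)) are orthogonal on a
   period although they are only 2 pi-antiperiodic: the products are
   differences of cosines of integer frequency. *)
Definition half_sin x (k : nat) t : R :=
  sin ((k%:R + 2^-1) * t - (k%:R + 2^-1) * x).

Lemma half_sin_continuous x k : circle_continuous (half_sin x k).
Proof. exact/circle_continuousW/continuous_sin_affine. Qed.

Lemma half_sinM x (i j : nat) t : (j <= i)%N ->
  half_sin x i t * half_sin x j t =
  2^-1 * cos ((i - j)%:R * t + - ((i - j)%:R * x))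
  + (- 2^-1) * cos ((i + j).+1%:R * t + - ((i + j).+1%:R * x)).
Proof.
move=> ji; rewrite /half_sin.
set A := (i%:R + _) * t - _; set B := (j%:R + _) * t - _.
have -> : (i - j)%:R * t + - ((i - j)%:R * x) = A - B.
  by rewrite natrB// /A /B; ring.
have -> : (i + j).+1%:R * t + - ((i + j).+1%:R * x) = A + B.
  by rewrite -natr1 natrD /A /B; field.
by move: A B => A B; rewrite cosB cosD; field.
Qed.

(** The sum frequency [i + j + 1] is never zero, so its cosine integrates to 0 and only the
    difference frequency remains. *)
Lemma cint_half_sinM x (i j : nat) : (j <= i)%N ->
  cint (fun t => half_sin x i t * half_sin x j t) =
  2^-1 * cint (fun t => cos ((i - j)%:R * t + - ((i - j)%:R * x))).
Proof.
move=> ji; rewrite (eq_cint (fun t => half_sinM x t ji)).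
have cc (k : nat) d : circle_continuous (fun t : R => cos (k%:R * t + d)).
  exact/circle_continuousW/continuous_cos_affine.
rewrite cintD; [|exact: circle_continuousZ..].
by rewrite !cintZ// [X in _ + _ * X]cint_cos// mulr0 addr0.
Qed.

Lemma cint_half_sin_sqr x (i : nat) :
  cint (fun t => half_sin x i t * half_sin x i t) = pi.
Proof.
rewrite cint_half_sinM// subnn.
under eq_cint do rewrite !mul0r subr0 cos0.
by rewrite cint_cst; field.
Qed.

Lemma cint_half_sin_orth x (i j : nat) : (j < i)%N ->
  cint (fun t => half_sin x i t * half_sin x j t) = 0.
Proof.
move=> ji; rewrite cint_half_sinM; last exact: ltnW.
by rewrite cint_cos ?subn_gt0 // mulr0.
Qed.

(** Bessel's inequality by induction on [m]: removing from [h] its component along [half_sin x n]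
    lowers the squared norm by at least [e ^+ 2 / pi] and, by orthogonality, keeps all later
    coefficients. *)
Lemma bessel_lower_bound h x e (n m : nat) : circle_continuous h -> 0 <= e ->
  (forall k, (n <= k)%N -> e <= `|cint (fun t => h t * half_sin x k t)|) ->
  m%:R * (e ^+ 2 / pi) <= cint (fun t => h t * h t).
Proof.
move=> + e0; elim: m n h => [|m IH] n h ch hn.
  by rewrite mul0r; apply: cint_ge0 => t; rewrite -expr2 sqr_ge0.
pose b := cint (fun t => h t * half_sin x n t).
pose s := half_sin x n.
have cs : circle_continuous s by exact: half_sin_continuous.
(* The projection coefficient is [b / pi] because [half_sin x n] has squared norm [pi]. *)
pose g t := h t + (- (b / pi)) * s t.
have cg : circle_continuous g.
  by apply: circle_continuousD => //; exact: circle_continuousZ.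
have chs : circle_continuous (fun t => h t * s t) by exact: circle_continuousM.
have chh : circle_continuous (fun t => h t * h t) by exact: circle_continuousM.
have css : circle_continuous (fun t => s t * s t) by exact: circle_continuousM.
have gg : cint (fun t => g t * g t) = cint (fun t => h t * h t) - b ^+ 2 / pi.
  transitivity (cint (fun t => h t * h t +
      ((- (2 * b / pi)) * (h t * s t) + (b / pi) ^+ 2 * (s t * s t)))).
    by apply: eq_cint => t; rewrite /g; ring.
  rewrite cintD//; last by apply: circle_continuousD; exact: circle_continuousZ.
  rewrite cintD; [|exact: circle_continuousZ..].
  rewrite !cintZ// -/b (cint_half_sin_sqr x n).
  by have := lt0r_neq0 (@pi_gt0 R); move: (pi : R) => p p0; field.
have := IH n.+1 g cg; rewrite gg.
suff gk k : (n < k)%N -> cint (fun t => g t * half_sin x k t) =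
    cint (fun t => h t * half_sin x k t).
  have eb : e ^+ 2 / pi <= b ^+ 2 / pi.
    rewrite ler_pM2r ?invr_gt0 ?pi_gt0//.
    by rewrite -[leRHS]real_normK ?num_real// lerXn2r ?nnegrE// hn.
  have gn k : (n < k)%N -> e <= `|cint (fun t => g t * half_sin x k t)|.
    by move=> nk; rewrite gk// hn// ltnW.
  move=> /(_ gn); rewrite -natr1 mulrDl mul1r lerBrDr; apply: le_trans.
  by rewrite lerD2l.
move=> nk; have ck : circle_continuous (half_sin x k) by exact: half_sin_continuous.
transitivity (cint (fun t => h t * half_sin x k t +
    (- (b / pi)) * (half_sin x k t * s t))).
  by apply: eq_cint => t; rewrite /g; ring.
rewrite cintD; [|exact: circle_continuousM|]; last first.
  by apply: circle_continuousZ; exact: circle_continuousM.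
rewrite cintZ; last exact: circle_continuousM.
by rewrite cint_half_sin_orth// mulr0 addr0.
Qed.

(** If all coefficients from [n] on had size at least [e], Bessel's inequality would put every
    multiple of [e ^+ 2 / pi] below the fixed integral of [h ^+ 2], against the Archimedean
    property. *)
Lemma half_sin_coeff_small h x e (n : nat) : circle_continuous h -> 0 < e ->
  exists2 k, (n <= k)%N & `|cint (fun t => h t * half_sin x k t)| < e.
Proof.
move=> ch e0; apply: contrapT => noex.
have hn k : (n <= k)%N -> e <= `|cint (fun t => h t * half_sin x k t)|.
  by move=> nk; rewrite leNgt; apply/negP => hk; apply: noex; exists k.
have ep : 0 < e ^+ 2 / pi by rewrite divr_gt0 ?exprn_gt0 ?pi_gt0.
set I := cint (fun t => h t * h t).
have /(_ (Num.bound (I / (e ^+ 2 / pi)))) :=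
  fun m => bessel_lower_bound m ch (ltW e0) hn.
apply/negP; rewrite -ltNge -ltr_pdivrMr// -/I.
apply: archi_boundP; apply: divr_ge0 (ltW ep).
by apply: cint_ge0 => t; rewrite -expr2 sqr_ge0.
Qed.

(** * Pointwise convergence along a subsequence and the truncation error *)

(** Caratheodory's criterion gives continuity of [q] at [x] only. Near any other point [q] agrees
    with the difference quotient, which is continuous there. *)
Lemma continuous_slope g x : (forall t, derivable g t 1) ->
  exists q, [/\ forall t, g t - g x = q t * (t - x), continuous q
              & q x = derive1 g x].
Proof.
move=> dg.
have hg : is_derive x 1 g (derive1 g x) by rewrite derive1E; exact: derivableP.
have [q [gq cq qx]] := (is_derive1_caratheodory g x _).1 hg.
exists q; split=> // t; have [->//|tx] := eqVneq t x.
have cgt := continuous_derivable dg.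
have ct : {for t, continuous (fun t => (g t - g x) * (t - x)^-1)}.
  apply: continuousM; first by apply: continuousB; [exact: cgt|exact: cvg_cst].
  apply: continuousV; first by rewrite subr_eq0.
  by apply: continuousB; [exact: cvg_id|exact: cvg_cst].
have qE z : z != x -> (g z - g x) * (z - x)^-1 = q z.
  by move=> zx; rewrite gq mulfK// subr_eq0.
rewrite /continuous_at -qE//; apply: cvg_trans ct.
apply: near_eq_cvg; near=> z; apply: qE; near: z.
by apply: open_neq.
Unshelve. all: by end_near. Qed.

(** The symmetric Fourier sum in real form: index [k] combines the frequencies [k + 1] and
    [- (k + 1)] into one cosine. *)
Definition fourier_sum f (n : nat) x : R :=
  (2 * pi)^-1 * cint f + \sum_(k < n)
    pi^-1 * cint (fun t => f t * cos (k.+1%:R * t + - (k.+1%:R * x))).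

Lemma fourier_sum_dirichlet f (n : nat) x : circle_continuous f ->
  2 * pi * fourier_sum f n x =
  cint (fun t => f t * (1 + 2 * \sum_(k < n) cos (k.+1%:R * (t - x)))).
Proof.
move=> cf; have pi0 := lt0r_neq0 (@pi_gt0 R).
pose G (k : nat) t := 2 * (f t * cos (k.+1%:R * t + - (k.+1%:R * x))).
have cfc (k : nat) : circle_continuous
    (fun t => f t * cos (k.+1%:R * t + - (k.+1%:R * x))).
  by apply: circle_continuousM => //; apply/circle_continuousW/continuous_cos_affine.
have cG k : circle_continuous (G k) by exact: circle_continuousZ.
transitivity (cint (fun t => f t + \sum_(k < n) G k t)); last first.
  apply: eq_cint => t; rewrite mulrDr mulr1; congr +%R.
  rewrite mulr_sumr mulr_sumr; apply: eq_bigr => k _.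
  by rewrite /G mulrBr; ring.
rewrite cintD//; last exact: circle_continuous_sum.
rewrite cint_sum// /fourier_sum mulrDr mulrA divff ?mul1r; last first.
  by rewrite mulf_neq0.
congr +%R; rewrite mulr_sumr; apply: eq_bigr => k _.
by rewrite /G cintZ// mulrA; congr *%R; rewrite -mulrA divff ?mulr1.
Qed.

Lemma sin_half_neq0 u : u != 0 -> `|u| < 2 * pi -> sin (u / 2) != 0 :> R.
Proof.
move=> u0 upi.
suff: sin (`|u| / 2) != 0.
  have [u_ge0|u_lt0] := leP 0 u; first by rewrite ger0_norm.
  by rewrite ltr0_norm// mulNr sinN oppr_eq0.
rewrite gt_eqF// sin_gt0_pi// divr_gt0 ?normr_gt0//=.
by rewrite ltr_pdivrMr// mulrC.
Qed.

(** With [x] interior, [sin ((t - x) / 2)] vanishes on the closed period only at [t = x]. Dividing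
    the slope [p] of [f] by the slope [q] of this sine gives a quotient [h] without singularity. *)
Lemma fourier_sum_converges f x e (n : nat) : (forall t, derivable f t 1) ->
  - pi < x < pi -> 0 < e ->
  exists2 k, (n <= k)%N & `|f x - fourier_sum f k x| < e.
Proof.
move=> df xpi e0; have cf := continuous_derivable df.
have dsin t : derivable (fun t => sin (2^-1 * t + - (2^-1 * x))) t 1.
  by have [] := is_derive_sin_affine 2^-1 (- (2^-1 * x)) t.
have [p [fp cp px]] := continuous_slope x df.
have [q [sq cq qx]] := continuous_slope x dsin.
have q0 t : - pi <= t <= pi -> q t != 0.
  move=> tpi; have [->|tx] := eqVneq t x.
    rewrite qx derive1E; have [_ ->] := is_derive_sin_affine 2^-1 (- (2^-1 * x)) x.
    by rewrite subrr cos0 mulr1 invr_neq0.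
  have : sin ((t - x) / 2) != 0.
    rewrite sin_half_neq0 ?subr_eq0// ltr_norml; lra.
  apply: contraNneq => qt; have := sq t.
  by rewrite qt mul0r subrr sin0 subr0 => <-; apply/eqP; congr sin; field.
pose h t := p t * (q t)^-1.
have ch : circle_continuous h.
  apply: continuous_in_subspaceT => t; rewrite inE/= in_itv/= => tpi.
  apply: (@continuousM _ _ p); first exact: cp.
  by apply: continuousV; [exact: q0|exact: cq].
have hE t : - pi <= t <= pi -> f t - f x = h t * sin ((t - x) / 2).
  move=> tpi; rewrite fp /h.
  have -> : sin ((t - x) / 2) = q t * (t - x).
    by have := sq t; rewrite subrr sin0 subr0 => <-; congr sin; field.
  by rewrite -mulrA mulKf ?q0.
have [k nk hk] := half_sin_coeff_small x n ch (mulr_gt0 two_pi_gt0 e0).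
exists k => //.
have D0 := fourier_sum_dirichlet k x (circle_continuousW cf).
have cK : circle_continuous
    (fun t : R => 1 + 2 * \sum_(j < k) cos (j.+1%:R * (t - x))).
  apply: circle_continuousD; first by apply: circle_continuousW => z; exact: cvg_cst.
  apply: circle_continuousZ; 
  apply: (@circle_continuous_sum k (fun j t => cos (j.+1%:R * (t - x)))) => j.
  suff -> : (fun t => cos (j.+1%:R * (t - x))) =
    (fun t => cos (j.+1%:R * t + - (j.+1%:R * x))).
    exact/circle_continuousW/continuous_cos_affine.
  by apply/funext => t; rewrite mulrBr.
(* The mass of the Dirichlet kernel is read off from the Fourier sum of the constant 1. *)
have D1 : cint (fun t => 1 + 2 * \sum_(j < k) cos (j.+1%:R * (t - x))) = 2 * pi :> R.
  have c1 : circle_continuous (fun=> 1 : R).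
    by apply: circle_continuousW => z; exact: cvg_cst.
  have := fourier_sum_dirichlet k x c1; under [in RHS]eq_cint do rewrite mul1r.
  move=> <-; rewrite /fourier_sum cint_cst mulr1.
  rewrite big1 => [|j _]; first by rewrite addr0 mulVf ?mulr1// lt0r_neq0// two_pi_gt0.
  by under eq_cint do rewrite mul1r; rewrite cint_cos// mulr0.
(* The kernel mass puts [f x] under the integral; the sine factor of [f t - f x] then turns the
   kernel into [half_sin x k]. *)
have E : cint (fun t => h t * half_sin x k t) = 2 * pi * (fourier_sum f k x - f x).
  rewrite mulrBr D0 -D1 [X in _ - X]mulrC -mulNr -cintZ//.
  rewrite -cintD; [|apply: circle_continuousM => //|exact: circle_continuousZ].
    apply: eq_cint_in => t tpi; rewrite -mulrDl hE//.
    by rewrite -mulrA dirichlet_kernel /half_sin mulrBr.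
  exact: circle_continuousW.
move: hk; rewrite E normrM gtr0_norm ?two_pi_gt0// ltr_pM2l ?two_pi_gt0//.
by rewrite distrC.
Qed.

(** Some Fourier sum of order [N >= n] is within [e] of [f x]. Passing from order [n] to [N] adds
    the frequencies [n + 1] to [N], each bounded by coefficient decay, uniformly in [N]; [e] is
    arbitrary. *)
Lemma fourier_sum_error f m L (n : nat) x : periodic f (pi *+ 2) ->
  class_C m.+1 f -> (1 <= m)%N ->
  (forall t, - pi <= t <= pi -> `|derive1n m.+1 f t| <= L) -> 0 <= L ->
  (1 <= n)%N -> - pi < x < pi ->
  `|f x - fourier_sum f n x| <= 2 * L / (m%:R * n%:R ^+ m).
Proof.
move=> pf Cf m1 fL L0 n1 xpi.
have df t : derivable f t 1 by have [+ _] := Cf; move=> /(_ 0%N isT t).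
apply/ler_addgt0Pr => e e0.
have [N nN xN] := fourier_sum_converges n df xpi e0.
rewrite -(subrKA (fourier_sum f N x)) addrC (le_trans (ler_normD _ _))//.
rewrite lerD ?(ltW xN)//.
pose a (k : nat) := pi^-1 * cint (fun t => f t * cos (k.+1%:R * t + - (k.+1%:R * x))).
have -> : fourier_sum f N x - fourier_sum f n x = \sum_(n <= k < N) a k.
  rewrite /fourier_sum opprD addrACA subrr add0r -!(big_mkord xpredT a).
  by rewrite (big_cat_nat _ nN)//= addrAC subrr add0r.
apply: (le_trans (ler_norm_sum _ _ _)).
apply: (@le_trans _ _ (\sum_(n <= k < N) 2 * L * (k.+1%:R ^+ m.+1)^-1)).
  apply: ler_sum => k _; rewrite normrM gtr0_norm ?invr_gt0 ?pi_gt0//.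
  rewrite mulrC ler_pdivrMr ?pi_gt0//.
  apply: le_trans (cint_cos_decay _ pf Cf fL (ltn0Sn k)) _.
  by rewrite le_eqVlt; apply/orP; left; apply/eqP; ring.
by rewrite -mulr_sumr ler_wpM2l ?mulr_ge0// sum_invX_le.
Qed.

(** * Complex form and the windowed error *)

(** The endpoints form a null set, and measurability of [g] on the open interval is inherited from
    [f]. This is needed because [psi_w] need not equal [w psi] at the endpoints. *)
Lemma eq_cint_oo f g : circle_continuous f ->
  (forall t, - pi < t < pi -> g t = f t) -> cint g = cint f.
Proof.
move=> cf gf; rewrite /cint /Rintegral; congr fine.
have mf : measurable_fun `]- pi, pi[%classic f.
  have /integrableP[/measurable_EFinP + _] := circle_integrable cf.
  by apply: measurable_funS => //; exact: subset_itv_oo_cc.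
apply: eq_integral_itv_bounded => //.
by apply: eq_measurable_fun mf => t; rewrite inE/= in_itv/= => /gf.
Qed.

Lemma windowed_coeffE psi w f (k : int) x : circle_continuous f ->
  (forall t, - pi < t < pi -> f t = w t * psi t) ->
  (windowed_coeff psi w k * expi (k%:~R * x) =
   ((2 * pi)^-1 * cint (fun t => f t * cos (k%:~R * t + - (k%:~R * x))))
   +i* (- ((2 * pi)^-1 * cint (fun t => f t * sin (k%:~R * t + - (k%:~R * x))))))%C.
Proof.
move=> cf fE; rewrite /windowed_coeff /complex_integral /expi.
(* Only the addition formulas are used, so the frequency and the normalizing factor become arbitrary
   reals. *)
move: (k%:~R : R) => c; move: ((2 * pi)^-1 : R) => p.
pose A := cint (fun t => f t * cos (c * t)).
pose B := cint (fun t => f t * sin (c * t)).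
have cfc d : circle_continuous (fun t => f t * cos (c * t + d)).
  by apply: circle_continuousM => //; exact/circle_continuousW/continuous_cos_affine.
have cfs d : circle_continuous (fun t => f t * sin (c * t + d)).
  by apply: circle_continuousM => //; exact/circle_continuousW/continuous_sin_affine.
have cA : circle_continuous (fun t => f t * cos (c * t)).
  suff <- : (fun t => f t * cos (c * t + 0)) = (fun t => f t * cos (c * t)) by [].
  by apply/funext => t; rewrite addr0.
have cB : circle_continuous (fun t => f t * sin (c * t)).
  suff <- : (fun t => f t * sin (c * t + 0)) = (fun t => f t * sin (c * t)) by [].
  by apply/funext => t; rewrite addr0.
have -> : \int[lebesgue_measure]_(t in `[- pi, pi])
    complex.Re ((psi t * w t)%:C%C * (cos (- (c * t)) +i* sin (- (c * t)))%C) = A.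
  apply: eq_cint_oo => // t /fE ->.
  by rewrite /= mul0r subr0 cosN [w t * _]mulrC.
have -> : \int[lebesgue_measure]_(t in `[- pi, pi])
    complex.Im ((psi t * w t)%:C%C * (cos (- (c * t)) +i* sin (- (c * t)))%C) = - B.
  rewrite -[RHS]mulN1r -cintZ//; apply: eq_cint_oo => [|t /fE ->].
    exact: circle_continuousZ.
  by rewrite /= mul0r addr0 sinN; ring.
have -> : cint (fun t => f t * cos (c * t + - (c * x))) =
    cos (c * x) * A + sin (c * x) * B.
  rewrite -!cintZ// -cintD; [|exact: circle_continuousZ..].
  by apply: eq_cint => t; rewrite cosB; ring.
have -> : cint (fun t => f t * sin (c * t + - (c * x))) =
    cos (c * x) * B + (- sin (c * x)) * A.
  rewrite -!cintZ// -cintD; [|exact: circle_continuousZ..].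
  by apply: eq_cint => t; rewrite sinB; ring.
by apply/eqP; rewrite eq_complex/=; apply/andP; split; apply/eqP; ring.
Qed.

Lemma sum_symmetric_int (V : zmodType) (G : int -> V) (n : nat) :
  \sum_(j < (2 * n)%N.+1) G (j%:Z - n%:Z) =
  G 0 + \sum_(k < n) (G k.+1%:Z + G (- k.+1%:Z)).
Proof.
elim: n => [|n IH]; first by rewrite big_ord1 big_ord0 !addr0.
rewrite mulnS !addSn add0n big_ord_recl big_ord_recr/= [in RHS]big_ord_recr/=.
(* With both end terms split off, the inner indices are shifted by one, which offsets the change
   from [n] to [n.+1]. *)
have -> : \sum_(i < (2 * n)%N.+1)
    G ((bump 0 (widen_ord (leqnSn (2 * n)%N.+1) i))%:Z - n.+1%:Z) =
    \sum_(j < (2 * n)%N.+1) G (j%:Z - n%:Z).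
  by apply: eq_bigr => i _; congr G; rewrite /bump/=; lia.
rewrite IH sub0r.
have -> : (bump 0 (2 * n)%N.+1)%:Z - n.+1%:Z = n.+1%:Z by rewrite /bump; lia.
by rewrite [LHS]addrC -!addrA.
Qed.

(** For opposite frequencies the imaginary parts are opposite and cancel, while the real parts
    agree, so that [1 / (2 pi)] doubles to [1 / pi]. *)
Lemma windowed_partial_sumE psi w f (n : nat) x : circle_continuous f ->
  (forall t, - pi < t < pi -> f t = w t * psi t) ->
  windowed_partial_sum psi w n x = (fourier_sum f n x)%:C%C.
Proof.
move=> cf fE; rewrite /windowed_partial_sum /=.
apply: etrans (sum_symmetric_int
  (fun k => windowed_coeff psi w k * expi (k%:~R * x)) n) _.
rewrite /fourier_sum rmorphD rmorph_sum/=; congr +%R.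
  rewrite (windowed_coeffE _ _ cf fE) !mul0r.
  under eq_cint do rewrite mul0r subr0 cos0 mulr1.
  under [X in (_ +i* (- (_ * X)))%C]eq_cint do rewrite mul0r subr0 sin0 mulr0.
  by rewrite cint_cst !mulr0 oppr0.
apply: eq_bigr => k _; rewrite !(windowed_coeffE _ _ cf fE).
rewrite mulrNz; set c : R := k.+1%:~R.
have -> : cint (fun t => f t * cos (- c * t + - (- c * x))) =
    cint (fun t => f t * cos (c * t + - (c * x))).
  by apply: eq_cint => t; rewrite -cosN; congr (_ * cos _); ring.
have -> : cint (fun t => f t * sin (- c * t + - (- c * x))) =
    - cint (fun t => f t * sin (c * t + - (c * x))).
  rewrite -[RHS]mulN1r -cintZ; last first.
    apply: circle_continuousM => //.
    exact/circle_continuousW/continuous_sin_affine.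
  by apply: eq_cint => t; rewrite mulrCA mulN1r -sinN; congr (_ * sin _); ring.
apply/eqP; rewrite eq_complex/=; apply/andP; split; apply/eqP; last by ring.
rewrite -mulrDl; congr *%R.
by have := lt0r_neq0 (@pi_gt0 R); move: (pi : R) => p p0; field.
Qed.

(** The partition of the interval at [x] has [|f x - f a|] among its increments, so the variation
    bounds it. *)
Lemma bounded_variation_bounded f a b : bounded_variation a b f ->
  exists M, forall x, a < x < b -> `|f x| <= M.
Proof.
move=> [M fM]; exists (M + `|f a|) => x /andP[ax xb].
rewrite -lerBlDr (le_trans (lerB_dist _ _))//.
have part : itv_partition a b [:: x; b] by split; rewrite /= ?ax ?xb//=.
apply: le_trans (fM _ (variations_variation f part)).
by rewrite /variation/= big_nat_recl// big_nat1/= lerDl.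
Qed.

(** Suprema behave well only on nonempty sets bounded above; the bound for the values of [F] is
    deduced from the one for [G]. *)
Lemma dist_sup_le (T : Type) (D : set T) (F G : T -> R) e : D !=set0 ->
  has_ubound [set G z | z in D] -> (forall z, D z -> `|F z - G z| <= e) ->
  `|sup [set F z | z in D] - sup [set G z | z in D]| <= e.
Proof.
move=> [z0 Dz0] ubG FG.
have supG z : D z -> G z <= sup [set G z | z in D].
  by move=> Dz; apply: ub_le_sup => //; exists z.
have F_le z : D z -> F z <= sup [set G z | z in D] + e.
  move=> Dz; have := FG z Dz; have := supG z Dz.
  by rewrite ler_norml => ? /andP[]; lra.
have ubF : has_ubound [set F z | z in D].
  by exists (sup [set G z | z in D] + e) => _ [z Dz <-]; exact: F_le.
rewrite ler_norml; apply/andP; split.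
  rewrite lerBrDr addrC lerBlDr; apply: ge_sup; first by exists (G z0), z0.
  move=> _ [z Dz <-].
  have : F z <= sup [set F z | z in D] by apply: ub_le_sup => //; exists z.
  by have := FG z Dz; rewrite ler_norml => /andP[]; lra.
rewrite lerBlDl; apply: ge_sup; first by exists (F z0), z0.
by move=> _ [z Dz <-]; exact: F_le.
Qed.

End fourier.

Theorem theorem3p3 (R : realType) (psi w psi_w : R -> R) (s : nat) (L rho : R) :
  BV_loc psi ->
  window_function w ->
  windowed_periodization psi w psi_w ->
  (1 <= s)%N ->
  class_C s.+1 psi_w ->
  is_lipschitz_constant `[- pi, pi] (derive1n s psi_w) L ->
  0 < L ->
  0 < rho < pi ->
  0 <= K_infty psi w rho /\
  forall n : nat, (1 <= n)%N ->
    `| sup_error psi w n rho - K_infty psi w rho |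
      <= 4 * L / (s%:R * n%:R ^+ s).
Proof.
move=> [bvpsi _] [_ _ w01 _] [per fE _] s1 Cf [lip _] L0 /andP[rho0 rhopi].
have rho_in x : `[- rho, rho]%classic x -> - pi < x < pi.
  by rewrite /= in_itv/=; lra.
have [M psiM] := bounded_variation_bounded (bvpsi _ _ (ltW (@Npi_lt_pi R))).
have K_ub : has_ubound [set `|psi x| * (1 - w x) | x in `[- rho, rho]].
  exists M => _ [x /rho_in xpi <-]; apply: le_trans (psiM _ xpi).
  by rewrite ler_piMr//; have := w01 x xpi; lra.
have zero_in : `[- rho, rho]%classic 0 by rewrite /= in_itv/=; lra.
split.
  apply: le_trans (ub_le_sup K_ub _); last by exists 0.
  by rewrite mulr_ge0// subr_ge0; have /andP[] := w01 _ (rho_in _ zero_in).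
move=> n n1; apply: dist_sup_le => //; first by exists 0.
have [df _] := Cf.
have derivL : forall t, - pi <= t <= pi -> `|derive1n s.+1 psi_w t| <= L.
  apply: lipschitz_derive1 => //; first exact: Npi_lt_pi.
  exact: df.
have cf : circle_continuous psi_w.
  by apply: circle_continuousW; exact: (class_C_continuous Cf (leq0n _)).
move=> x /rho_in xpi; rewrite (windowed_partial_sumE n x cf fE) -rmorphB/=.
(* The partial sum is real, so the complex modulus reduces to a real absolute value. *)
rewrite expr0n addr0 sqrtr_sqr.
have /andP[_ w1] := w01 x xpi.
(* Writing the [K_infty] term as one absolute value allows the reverse triangle inequality, after
   which only [psi_w] minus its Fourier sum remains. *)
rewrite -[1 - w x]ger0_norm ?subr_ge0// -normrM.
apply: le_trans (ler_dist_dist _ _) _.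
have -> : psi x - fourier_sum psi_w n x - psi x * (1 - w x) =
    psi_w x - fourier_sum psi_w n x by rewrite fE//; ring.
apply: le_trans (fourier_sum_error per Cf s1 derivL (ltW L0) n1 xpi) _.
(* The Fourier error has constant 2, relaxed here to 4. *)
rewrite ler_wpM2r ?invr_ge0 ?mulr_ge0 ?exprn_ge0//.
by rewrite ler_wpM2r ?(ltW L0)// ler_nat.
Qed.
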